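(* Let $N$ be a sequential logic network with $m$ primary inputs, $n$ primary outputs and $\ell$ registers with initial state $s_0\in\{0,1\}^\ell$, and let $N^b$ and $N^i$ be its 1-step base case network and 1-step inductive case network. Let $\Delta$ be a logic transformation of $N$, and let $N_\Delta$, $N^b_\Delta$, $N^i_\Delta$ be, respectively, the networks obtained by applying $\Delta$ to $N$, to all frames of $N^b$, and to the last frame of $N^i$. If $N^b$ is combinationally equivalent to $N^b_\Delta$ and $N^i$ is combinationally equivalent to $N^i_\Delta$, then $N$ and $N_\Delta$ are sequentially equivalent.
   Context: A (sequential) logic network is a directed acyclic graph whose nodes are logic gates computing Boolean functions of their fanins; its source nodes are primary inputs (PIs) or register outputs (ROs), its sinks are primary outputs (POs) or register inputs (RIs); each register is a pair (RI, RO) with an initial value, and at each clock cycle the RO takes the value the corresponding RI had in the previous cycle (the ROs hold the initial values in the first cycle). Given an input pattern $x\in\{0,1\}^m$ on the PIs and a state $y\in\{0,1\}^\ell$ on the ROs, $N(x,y)$ denotes the resulting values on the RIs and POs. The $k$-step base case network $N^b$ is the purely combinational network obtained by taking $k$ copies (frames) of $N$, connecting the RIs of each frame to the corresponding ROs of the next frame, replacing the ROs of the first frame by the registers' initial values, and designating the RIs of the last frame as POs (the POs of each frame remain POs). The $k$-step inductive case network $N^i$ is defined in the same way but with $k+1$ frames and with the ROs of the first frame taken as PIs instead of being fixed to initial values. Here $k=1$, so $N^b$ has one frame and $N^i$ has two frames. A logic transformation $\Delta$ is a local modification of a gate of the network (e.g. replacing a fanin of a gate by a constant or by another existing node not in its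 transitive fanout, with the gate's function adjusted accordingly); applying it in a frame means applying it to the copy of that gate in that frame. Two combinational networks are combinationally equivalent if they produce the same output values for every input pattern. Two sequential networks with the same initial state are sequentially equivalent if, starting from the initial state, they produce the same primary output sequences for every sequence of primary input patterns. *)

(* Defs.v *)
From mathcomp Require Import all_boot.
Set Implicit Arguments.
Unset Strict Implicit.
Unset Printing Implicit Defensive.

(* A fanin (or the driver of a sink) is a constant, a source node of the
   network, or the output of another gate. *)
Inductive signal (I G : Type) : Type :=
  | Const of bool
  | Source of I
  | Gate of G.
Arguments Const {I G} b.
Arguments Source {I G} i.
Arguments Gate {I G} g.

Record gate (I G : Type) := MkGate {
  arity : nat;
  fanins : arity.-tuple (signal I G);
  func : arity.-tuple bool -> bool }.

(* A circuit with source nodes I, gates G and sinks O.  Being acyclic is the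
   separate predicate [acyclic]. *)
Record circuit (I G O : finType) := MkCircuit {
  gates : G -> gate I G;
  driver : O -> signal I G }.

Definition pattern (T : finType) := {ffun T -> bool}.

Section Circuit.
Variables I G O : finType.
Implicit Types (A : circuit I G O) (x : pattern I) (v : pattern G).

Definition is_gate (g : G) (s : signal I G) : bool :=
  if s is Gate h then h == g else false.

Definition edge A : rel G := fun g h => has (is_gate g) (fanins (gates A h)).

Definition acyclic A := forall g h, edge A g h -> ~~ connect (edge A) h g.

Definition sigval x v (s : signal I G) : bool :=
  match s with Const b => b | Source i => x i | Gate g => v g end.

Definition gate_step A x v : pattern G :=
  [ffun g => func (map_tuple (sigval x v) (fanins (gates A g)))].

(* On an acyclic circuit, #|G| rounds of simultaneous gate evaluation reach the
   unique valuation satisfying all gate equations: see [gate_valuesP] and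
   [gate_values_uniq]. *)
Definition gate_values A x : pattern G :=
  iter #|G| (gate_step A x) [ffun=> false].

Definition eval A x : pattern O :=
  [ffun o => sigval x (gate_values A x) (driver A o)].

(* Simultaneous replacement of the gates g such that D g = Some c by c. *)
Definition replace A (D : G -> option (gate I G)) : circuit I G O :=
  MkCircuit (fun g => odflt (gates A g) (D g)) (driver A).

Lemma rank_acyclic A (rank : G -> nat) :
  (forall g h, edge A g h -> rank g < rank h) -> acyclic A.
Proof.
move=> rk g h gh; apply/negP => /connectP [p].
have le_last q z : path (edge A) z q -> rank z <= rank (last z q).
  elim: q z => //= w q IHq z /andP [zw wq].
  exact: leq_trans (ltnW (rk _ _ zw)) (IHq _ wq).
by move=> /le_last le_h gE; move: (rk _ _ gh); rewrite ltnNge gE le_h.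
Qed.

Lemma acyclic_bounded_rank A : acyclic A ->
  exists2 rank : G -> nat, forall g h, edge A g h -> rank g < rank h
    & forall g, 0 < rank g <= #|G|.
Proof.
move=> acA; exists (fun g => #|[pred h | connect (edge A) h g]|).
  move=> g h gh; apply/proper_card/properP; split.
    by apply/subsetP => z; rewrite !inE => /connect_trans; apply; apply: connect1.
  by exists h; rewrite !inE ?connect0 //; exact: acA.
move=> g; rewrite max_card andbT; apply/card_gt0P; exists g.
by rewrite inE connect0.
Qed.

Lemma eq_gate_step A x v v' g :
  (forall h, edge A h g -> v h = v' h) ->
  gate_step A x v g = gate_step A x v' g.
Proof.
rewrite /edge /gate_step !ffunE; case: (gates A g) => a fs f /= eqv.
congr f; apply: val_inj => /=.
elim: (tval fs) eqv => //= s r IHr eqv; congr cons.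
  case: s eqv => //= h eqv; apply: eqv; by rewrite eqxx.
by apply: IHr => h hr; apply: eqv; rewrite hr orbT.
Qed.

Lemma iter_gate_step A x v v' : acyclic A ->
  iter #|G| (gate_step A x) v = iter #|G| (gate_step A x) v'.
Proof.
move=> /acyclic_bounded_rank [rank rk bnd]; apply/ffunP => g.
have /andP [_] := bnd g; elim: #|G| g => [|t IHt] g le_gt.
  by have /andP [] := bnd g; rewrite ltnNge le_gt.
apply: eq_gate_step => h /rk hg; apply: IHt.
by rewrite -ltnS (leq_trans hg).
Qed.

Lemma gate_valuesP A x : acyclic A ->
  gate_step A x (gate_values A x) = gate_values A x.
Proof. by move=> acA; rewrite /gate_values -iterS iterSr; exact: iter_gate_step. Qed.

Lemma gate_values_uniq A x v : acyclic A ->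
  gate_step A x v = v -> v = gate_values A x.
Proof.
move=> acA fix_v; rewrite /gate_values (iter_gate_step _ _ v acA).
by elim: #|G| => //= t <-.
Qed.

End Circuit.

Definition comb_equiv (I G G' O : finType)
    (A : circuit I G O) (A' : circuit I G' O) :=
  forall x : pattern I, eval A x = eval A' x.

(* The sources are the PIs (inl) and the ROs (inr); the sinks are the POs (inl)
   and the RIs (inr). *)
Record network (m n l : nat) (G : finType) := MkNetwork {
  core :> circuit ('I_m + 'I_l)%type G ('I_n + 'I_l)%type;
  init : pattern 'I_l }.

Section Sequential.
Variables (m n l : nat) (G : finType).
Implicit Types (N : network m n l G) (x : pattern 'I_m) (y : pattern 'I_l).

Definition join x y : pattern ('I_m + 'I_l)%type :=
  [ffun s => match s with inl i => x i | inr r => y r end].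

Definition po N x y : pattern 'I_n := [ffun j => eval N (join x y) (inl j)].
Definition ri N x y : pattern 'I_l := [ffun r => eval N (join x y) (inr r)].

Fixpoint state N (xs : nat -> pattern 'I_m) (t : nat) : pattern 'I_l :=
  if t is t'.+1 then ri N (xs t') (state N xs t') else init N.

Definition po_sequence N xs (t : nat) : pattern 'I_n :=
  po N (xs t) (state N xs t).

End Sequential.

Definition seq_equiv (m n l : nat) (G G' : finType)
    (N : network m n l G) (N' : network m n l G') :=
  init N = init N' /\
  forall (xs : nat -> pattern 'I_m) (t : nat),
    po_sequence N xs t = po_sequence N' xs t.

(* K frames of N.  J is the type of the primary inputs of the unrolled circuit,
   [pi] places the PIs of the frames among them, and [first] says what stands
   for the ROs of frame 0.  The sinks are the POs of all frames and the RIs of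
   the last frame. *)
Section Unroll.
Variables (m n l : nat) (G : finType) (N : network m n l G) (K : nat).
Variables (J : finType) (pi : 'I_K * 'I_m -> J).
Variable first : 'I_l -> signal J ('I_K * G)%type.

(* What the RO r of frame f is connected to; f = K gives the RIs of the last
   frame.  The recursion is needed since an RI may be driven directly by an
   RO. *)
Fixpoint ro_signal (f : nat) : f <= K -> 'I_l -> signal J ('I_K * G)%type :=
  match f with
  | 0 => fun _ r => first r
  | f'.+1 => fun (lt_f'K : f' < K) r =>
      match driver N (inr r) with
      | Const b => Const b
      | Source (inl i) => Source (pi (Ordinal lt_f'K, i))
      | Source (inr r') => ro_signal (ltnW lt_f'K) r'
      | Gate g => Gate (Ordinal lt_f'K, g)
      end
  end.

Definition copy_signal (f : 'I_K) (s : signal ('I_m + 'I_l)%type G) :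
    signal J ('I_K * G)%type :=
  match s with
  | Const b => Const b
  | Source (inl i) => Source (pi (f, i))
  | Source (inr r) => ro_signal (ltnW (ltn_ord f)) r
  | Gate g => Gate (f, g)
  end.

Definition copy_gate (f : 'I_K) (c : gate ('I_m + 'I_l)%type G) :
    gate J ('I_K * G)%type :=
  MkGate (map_tuple (copy_signal f) (fanins c)) (@func _ _ c).

Definition unroll : circuit J ('I_K * G)%type ('I_K * 'I_n + 'I_l)%type :=
  MkCircuit (fun p => copy_gate p.1 (gates N p.2))
    (fun o => match o with
              | inl (f, j) => copy_signal f (driver N (inl j))
              | inr r => ro_signal (leqnn K) r
              end).

Hypothesis firstP : forall r p, ~~ is_gate p (first r).

Lemma ro_signal_gate f (le_fK : f <= K) r p :
  is_gate p (ro_signal le_fK r) -> p.1 < f.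
Proof.
elim: f le_fK r => /= [_ r|f IHf lt_fK r]; first by rewrite (negbTE (firstP r p)).
case: (driver N (inr r)) => //= [[i|r']|g] //=.
  by move=> /IHf /leqW.
by move=> /eqP <- /=.
Qed.

Lemma has_copy (f f' : 'I_K) g ss :
  has (is_gate (f, g)) (map (copy_signal f') ss) ->
  f < f' \/ f = f' /\ has (is_gate g) ss.
Proof.
elim: ss => //= s ss IHss /orP [|/IHss [|[-> ->]]]; last 2 first.
- by left.
- by right; rewrite orbT.
case: s => //= [[i|r]|g'] //=; first by move=> /ro_signal_gate; left.
by move=> /eqP [<- <-]; right; rewrite eqxx.
Qed.

Lemma copies_acyclic (O : finType) (A : circuit J ('I_K * G)%type O)
    (c : 'I_K -> G -> gate ('I_m + 'I_l)%type G) (rank : 'I_K -> G -> nat) M :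
  (forall p, gates A p = copy_gate p.1 (c p.1 p.2)) ->
  (forall f g h, has (is_gate g) (fanins (c f h)) -> rank f g < rank f h) ->
  (forall f g, rank f g < M) -> acyclic A.
Proof.
move=> Ac rk ltM; apply: (rank_acyclic (rank := fun p : 'I_K * G => p.1 * M + rank p.1 p.2)).
move=> [f g] [f' h]; rewrite /edge Ac /= => /has_copy [lt_f | [-> gh]].
  apply: leq_trans (leq_addr _ _); apply: (@leq_trans (f.+1 * M)).
    by rewrite mulSn addnC ltn_add2r.
  by rewrite leq_mul2r lt_f orbT.
by rewrite ltn_add2l; exact: rk.
Qed.

End Unroll.

(* The target gate is replaced by an arbitrary gate over existing nodes. *)
Record transformation (m l : nat) (G : finType) := MkTransformation {
  target : G;
  new_gate : gate ('I_m + 'I_l)%type G }.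

Section Transformation.
Variables (m n l : nat) (G : finType).
Variables (N : network m n l G) (D : transformation m l G).

(* [connect] is reflexive, so the target itself is excluded as a fanin. *)
Definition is_transformation :=
  forall h : G, has (is_gate h) (fanins (new_gate D)) ->
    ~~ connect (edge N) (target D) h.

Definition transform : network m n l G :=
  MkNetwork
    (replace N (fun g => if g == target D then Some (new_gate D) else None))
    (init N).

(* Apply D to the copies of its target in the frames belonging to F. *)
Definition unroll_transform (K : nat) (J : finType) (pi : 'I_K * 'I_m -> J)
    (first : 'I_l -> signal J ('I_K * G)%type) (F : pred 'I_K) :=
  replace (unroll N pi first)
    (fun p => if F p.1 && (p.2 == target D)
              then Some (copy_gate N pi first p.1 (new_gate D)) else None).

Hypotheses (acN : acyclic N) (isD : is_transformation).

Lemma transformation_rank :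
  exists r : bool -> G -> nat,
    [/\ forall g h, edge N g h -> r false g < r false h,
        forall g h, edge transform g h -> r true g < r true h
      & forall b g, r b g < (#|G|.+1).*2].
Proof.
have [rank rk bnd] := acyclic_bounded_rank acN.
have le_rank g : rank g <= #|G| by have /andP [] := bnd g.
exists (fun b g => rank g +
          if b && connect (edge N) (target D) g then #|G|.+1 else 0); split.
- by move=> g h /rk; rewrite !addn0.
- move=> g h; rewrite /edge /=; case: eqP => [-> /= gh | _ gh].
    by rewrite connect0 (negbTE (isD gh)) addn0 addnS ltnS (leq_trans (le_rank g)) ?leq_addl.
  have /= Ngh : edge N g h := gh.
  rewrite -addSn; apply: leq_add; first exact: rk.
  case: ifP => // /connect_trans -> //; exact: connect1.
- move=> b g; rewrite -addnn addSn ltnS.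
  by apply: leq_add => //; case: ifP.
Qed.

Lemma transform_acyclic : acyclic transform.
Proof. by have [r [_ r1 _]] := transformation_rank; apply: rank_acyclic r1. Qed.

Lemma unroll_transform_acyclic K (J : finType) (pi : 'I_K * 'I_m -> J) first F :
  (forall r p, ~~ is_gate p (first r)) ->
  acyclic (unroll_transform pi first F).
Proof.
move=> firstP; have [r [r0 r1 bnd]] := transformation_rank.
apply: (copies_acyclic firstP (rank := fun f => r (F f)) (M := (#|G|.+1).*2)
  (c := fun f g => if F f && (g == target D) then new_gate D else gates N g)) => //.
  by move=> [f g] /=; case: ifP.
move=> f g h; case: (F f) => /=; last exact: r0.
by move=> gh; apply: r1; rewrite /edge /=; case: eqP gh.
Qed.

Section Cases.
Variable k : nat.

(* The ROs of the first frame are the initial values in the base case, and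
   additional primary inputs (inr) in the inductive case. *)
Definition base_pi (p : 'I_k * 'I_m) : ('I_k * 'I_m)%type := p.
Definition base_first (r : 'I_l) :
  signal ('I_k * 'I_m)%type ('I_k * G)%type := Const (init N r).

Definition base_case := unroll N base_pi base_first.
Definition base_case_transform := unroll_transform base_pi base_first xpredT.

Definition ind_pi (p : 'I_k.+1 * 'I_m) : ('I_k.+1 * 'I_m + 'I_l)%type := inl p.
Definition ind_first (r : 'I_l) :
  signal ('I_k.+1 * 'I_m + 'I_l)%type ('I_k.+1 * G)%type := Source (inr r).

Definition inductive_case := unroll N ind_pi ind_first.
Definition inductive_case_transform :=
  unroll_transform ind_pi ind_first (pred1 ord_max).

Lemma base_case_transform_acyclic : acyclic base_case_transform.
Proof. exact: unroll_transform_acyclic. Qed.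

Lemma inductive_case_transform_acyclic : acyclic inductive_case_transform.
Proof. exact: unroll_transform_acyclic. Qed.

End Cases.
End Transformation.

Lemma unroll_acyclic m n l (G : finType) (N : network m n l G) K (J : finType)
    (pi : 'I_K * 'I_m -> J) first :
  acyclic N -> (forall r p, ~~ is_gate p (first r)) ->
  acyclic (unroll N pi first).
Proof.
move=> /acyclic_bounded_rank [rank rk bnd] firstP.
apply: (copies_acyclic firstP (c := fun=> gates N) (rank := fun=> rank)
  (M := #|G|.+1)) => // f g; by have /andP [] := bnd g.
Qed.

Lemma base_case_acyclic m n l (G : finType) (N : network m n l G) k :
  acyclic N -> acyclic (base_case N k).
Proof. by move=> acN; exact: unroll_acyclic. Qed.

Lemma inductive_case_acyclic m n l (G : finType) (N : network m n l G) k :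
  acyclic N -> acyclic (inductive_case N k).
Proof. by move=> acN; exact: unroll_acyclic. Qed.

(* Main.v *)
Require Import Defs.
From mathcomp Require Import all_boot.
Set Implicit Arguments.
Unset Strict Implicit.
Unset Printing Implicit Defensive.

(* Gate values on an acyclic circuit are the unique fixed point of [gate_step],
   so an unrolled circuit computes in each frame what that frame's network
   computes from the state handed over by the previous frames.  The base case
   thus says that N and its transform agree (outputs and next state) in the
   initial state, and the inductive case that they agree in every state that is
   an N-successor of some state.  All states reached by N are of one of these
   two kinds, so both networks run through the same states. *)

Section UnrolledEvaluation.
Variables (m n l : nat) (G : finType).
Variables (N : network m n l G) (D : transformation m l G).
Variables (K : nat) (J : finType) (pi : 'I_K * 'I_m -> J).
Variables (first : 'I_l -> signal J ('I_K * G)%type) (F : pred 'I_K).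
Hypotheses (acN : acyclic N) (isD : is_transformation N D).
Hypothesis firstP : forall r p, ~~ is_gate p (first r).

Definition frame_network (f : 'I_K) : network m n l G :=
  if F f then transform N D else N.

Definition frame_input (x : pattern J) (f : 'I_K) : pattern 'I_m :=
  [ffun i => x (pi (f, i))].

(** The state entering each frame is characterised by equations rather than defined: [frame_network]
    exists only for ordinals below [K], while the sequence must also reach [st K], the RIs of the
    last frame. *)
Variables (x : pattern J) (st : nat -> pattern 'I_l).
Hypothesis st0 : forall v r, sigval x v (first r) = st 0 r.
Hypothesis stS : forall f : 'I_K,
  st f.+1 = ri (frame_network f) (frame_input x f) (st f).

Let frame_pattern (f : 'I_K) := join (frame_input x f) (st f).

Let frame_values : pattern ('I_K * G)%type :=
  [ffun p => gate_values (frame_network p.1) (frame_pattern p.1) p.2].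

Lemma driver_frame_network f : driver (frame_network f) = driver N.
Proof. by rewrite /frame_network; case: (F f). Qed.

(** [ro_signal] looks up drivers in [N] even for transformed frames; this is sound because replacing
    a gate leaves the drivers unchanged. *)
Lemma sigval_ro_signal f (le_fK : f <= K) r :
  sigval x frame_values (ro_signal N pi first le_fK r) = st f r.
Proof.
elim: f le_fK r => [|f IHf] lt_fK r /=; first exact: st0.
rewrite (stS (Ordinal lt_fK)) /ri /eval !ffunE driver_frame_network.
by case: (driver N (inr r)) => [b|[i|r']|g] //=; rewrite ?ffunE.
Qed.

Lemma sigval_copy_signal f s :
  sigval x frame_values (copy_signal N pi first f s)
    = sigval (frame_pattern f)
        (gate_values (frame_network f) (frame_pattern f)) s.
Proof.
case: s => [b|[i|r]|g] //=; rewrite ?ffunE //; exact: sigval_ro_signal.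
Qed.

Lemma gate_values_unroll_transform :
  gate_values (unroll_transform N D pi first F) x = frame_values.
Proof.
apply/esym/gate_values_uniq; first exact: unroll_transform_acyclic.
apply/ffunP => -[f g].
have acf : acyclic (frame_network f).
  rewrite /frame_network; case: (F f) => //; exact: transform_acyclic.
(* Unfolding one evaluation round of the frame on the right makes both sides a gate function applied
   to fanin values. *)
rewrite [RHS]ffunE -(gate_valuesP _ acf) !ffunE /=.
(* Copying a gate into a frame commutes with replacing it. *)
have -> : odflt (copy_gate N pi first f (gates N g))
    (if F f && (g == target D)
     then Some (copy_gate N pi first f (new_gate D)) else None)
    = copy_gate N pi first f (gates (frame_network f) g).
  by rewrite /frame_network; case: (F f) => //=; case: ifP.
congr func; apply: val_inj; rewrite /= -map_comp.
by apply: eq_map => s; exact: sigval_copy_signal.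
Qed.

Lemma eval_unroll_transform_po f j :
  eval (unroll_transform N D pi first F) x (inl (f, j))
    = po (frame_network f) (frame_input x f) (st f) j.
Proof.
rewrite !ffunE gate_values_unroll_transform /= driver_frame_network.
exact: sigval_copy_signal.
Qed.

Lemma eval_unroll_transform_ri r :
  eval (unroll_transform N D pi first F) x (inr r) = st K r.
Proof.
rewrite ffunE gate_values_unroll_transform; exact: sigval_ro_signal.
Qed.

End UnrolledEvaluation.

Section OneStep.
Variables (m n l : nat) (G : finType).
Variables (N : network m n l G) (D : transformation m l G).
Hypotheses (acN : acyclic N) (isD : is_transformation N D).

Definition agree_at (y : pattern 'I_l) := forall x,
  po N x y = po (transform N D) x y /\ ri N x y = ri (transform N D) x y.

Lemma base_case_agree :
  comb_equiv (base_case N 1) (base_case_transform N D 1) ->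
  agree_at (init N).
Proof.
move=> eqb x.
pose xx : pattern ('I_1 * 'I_m)%type := [ffun p => x p.2].
have xxE f : frame_input (@base_pi m 1) xx f = x.
  by apply/ffunP => i; rewrite !ffunE.
(* [N'] stands for the network in the only frame, so one definition serves both unrollings. *)
pose st (N' : network m n l G) t := if t is 0 then init N else ri N' x (init N).
have firstP r p : ~~ is_gate p (base_first N 1 r) by [].
have st0 N' v r : sigval xx v (base_first N 1 r) = st N' 0 r by [].
have stS (F : pred 'I_1) (f : 'I_1) :
    st (frame_network N D F ord0) f.+1
    = ri (frame_network N D F f) (frame_input (@base_pi m 1) xx f)
         (st (frame_network N D F ord0) f).
  by rewrite (ord1 f) xxE.
(* The untransformed unrolling is convertible to the one transformed in no
   frame. *)
have {eqb} eqb : eval (unroll_transform N D (@base_pi m 1) (base_first N 1) pred0) xx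
  = eval (unroll_transform N D (@base_pi m 1) (base_first N 1) xpredT) xx.
  exact: eqb.
split; apply/ffunP => j.
- have := congr1 (fun w : pattern _ => w (inl (ord0, j))) eqb.
  rewrite !(eval_unroll_transform_po acN isD firstP (st0 _) (stS _)).
  by rewrite xxE.
- have := congr1 (fun w : pattern _ => w (inr j)) eqb.
  by rewrite !(eval_unroll_transform_ri acN isD firstP (st0 _) (stS _)).
Qed.

(** On inputs [x0] and [x] with ROs [y], the first frame is untransformed in both circuits and hands
    [ri N x0 y] to the second, whose POs and RIs are then compared. *)
Lemma inductive_case_agree x0 y :
  comb_equiv (inductive_case N 1) (inductive_case_transform N D 1) ->
  agree_at (ri N x0 y).
Proof.
move=> eqi x.
pose xx : pattern ('I_2 * 'I_m + 'I_l)%type :=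
  [ffun s => match s with
             | inl (f, i) => (if f == ord0 then x0 else x) i
             | inr r => y r
             end].
have xxE f : frame_input (@ind_pi m l 1) xx f = if f == ord0 then x0 else x.
  by apply/ffunP => i; rewrite !ffunE.
(* Only the state after the last frame may depend on the transformation. *)
pose st (N' : network m n l G) t :=
  match t with 0 => y | 1 => ri N x0 y | _ => ri N' x (ri N x0 y) end.
have firstP r p : ~~ is_gate p (@ind_first m l G 1 r) by [].
have st0 N' v r : sigval xx v (@ind_first m l G 1 r) = st N' 0 r.
  by rewrite /= ffunE.
have stS (F : pred 'I_2) : F ord0 = false -> forall f : 'I_2,
    st (frame_network N D F ord_max) f.+1
    = ri (frame_network N D F f) (frame_input (@ind_pi m l 1) xx f)
         (st (frame_network N D F ord_max) f).
  move=> F0 f; rewrite xxE; have [->|] := eqVneq f ord0.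
    by rewrite /frame_network F0.
  have [->|] := eqVneq f ord_max => //.
  by case: f => [[|[|]]].
have {eqi} eqi : eval (unroll_transform N D (@ind_pi m l 1) (@ind_first m l G 1) pred0) xx
  = eval (unroll_transform N D (@ind_pi m l 1) (@ind_first m l G 1) (pred1 ord_max)) xx.
  exact: eqi.
have no0 : @pred0 'I_2 ord0 = false by [].
have max0 : pred1 (@ord_max 1) ord0 = false by [].
split; apply/ffunP => j.
- have := congr1 (fun w : pattern _ => w (inl (ord_max, j))) eqi.
  rewrite (eval_unroll_transform_po acN isD firstP (st0 _) (stS _ no0)).
  rewrite (eval_unroll_transform_po acN isD firstP (st0 _) (stS _ max0)).
  by rewrite xxE.
- have := congr1 (fun w : pattern _ => w (inr j)) eqi.
  rewrite (eval_unroll_transform_ri acN isD firstP (st0 _) (stS _ no0)).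
  by rewrite (eval_unroll_transform_ri acN isD firstP (st0 _) (stS _ max0)).
Qed.

End OneStep.

Theorem theorem1 (m n l : nat) (G : finType) (N : network m n l G)
    (D : transformation m l G) :
  acyclic N -> is_transformation N D ->
  comb_equiv (base_case N 1) (base_case_transform N D 1) ->
  comb_equiv (inductive_case N 1) (inductive_case_transform N D 1) ->
  seq_equiv N (transform N D).
Proof.
move=> acN isD eqb eqi; split=> // xs t.
(* A case split suffices: a later state is an [N]-successor by definition, and the inductive case
   covers successors of arbitrary states. *)
have agree t' : agree_at N D (state N xs t').
  case: t' => [|t']; first exact: base_case_agree.
  exact: inductive_case_agree.
have eq_state : state (transform N D) xs t = state N xs t.
  elim: t => //= t ->; by have [_ ->] := agree t (xs t).
by rewrite /po_sequence eq_state; have [-> _] := agree t (xs t).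
Qed.
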